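(* Let $g$ be an arithmetic function on $\mathbb{N}$ with $g(1)=1$ such that $\sum_{n=1}^{\infty} g(n)T^n$ is analytic at $T=0$, and let $\tilde g(n)=g(n)/n$. Let $n\ge 1$. If the polynomial $P_n^{\tilde g,1}(x)$ is log-concave, then the polynomial $P_n^{g,\mathrm{id}}(x)$ is log-concave.
   Context: Here $\mathbb{N}=\{1,2,3,\dots\}$, $\mathrm{id}(n)=n$ and $1(n)=1$. For arithmetic functions $g,h$ on $\mathbb{N}$ with $g(1)=h(1)=1$ and $h$ nowhere zero, the polynomials $P_n^{g,h}(x)$ are defined by $P_0^{g,h}(x)=1$ and $P_n^{g,h}(x)=\frac{x}{h(n)}\sum_{k=1}^{n} g(k)\,P_{n-k}^{g,h}(x)$ for $n\ge 1$. A sequence $\{a_m\}_{m\ge 0}$ of non-negative real numbers (a finite sequence being extended by zeros) is log-concave if $a_m^2\ge a_{m-1}a_{m+1}$ for all $m\ge 1$. A polynomial is log-concave if its sequence of coefficients consists of non-negative reals and is log-concave. *)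

(* Defs.v *)
From mathcomp Require Import all_boot all_order all_algebra.
From mathcomp Require Import all_classical all_reals topology normedtype.
From mathcomp Require Import sequences.
From mathcomp Require Import complex.

Set Implicit Arguments.
Unset Strict Implicit.
Unset Printing Implicit Defensive.

Import Order.TTheory GRing.Theory Num.Theory.
Import numFieldNormedType.Exports.

Local Open Scope classical_set_scope.
Local Open Scope ring_scope.

(* An arithmetic function on {1, 2, 3, ...} is a function g : nat -> K whose
   value at 0 is junk: no definition below depends on g 0. *)

Section RecursivePolynomials.
Variables (K : fieldType) (g h : nat -> K).

(* The list [:: P_n; P_(n-1); ...; P_0]; in the successor case the entry of
   index k of the list for m is P_(m-k) = P_(m+1-(k+1)). *)
Fixpoint recpolys (n : nat) : seq {poly K} :=
  if n is m.+1 then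
    let s := recpolys m in
    ((h n)^-1 *: 'X * \sum_(1 <= k < n.+1) g k *: s`_k.-1) :: s
  else [:: 1].

Definition recpoly (n : nat) : {poly K} := (recpolys n)`_0.

Lemma nth_recpolys n k : (k <= n)%N -> (recpolys n)`_k = recpoly (n - k).
Proof.
elim: n k => [|n IHn] [|k] //=.
by rewrite ltnS subSS; exact: IHn.
Qed.

(* The defining recursion of the family, which determines it. *)
Lemma recpoly0 : recpoly 0 = 1.
Proof. by []. Qed.

Lemma recpolyE n : (0 < n)%N ->
  recpoly n =
    (h n)^-1 *: 'X * \sum_(1 <= k < n.+1) g k *: recpoly (n - k).
Proof.
case: n => // n _; rewrite {1}/recpoly /=; congr (_ * _).
apply: eq_big_nat => -[|k] // /andP[_ lekn].
by rewrite /= nth_recpolys // subSS.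
Qed.

End RecursivePolynomials.

(* The order of a numDomainType such as R[i] is partial and 0 <= z entails
   that z is real. Coefficients beyond the degree are 0. *)
Definition log_concave (K : numDomainType) (a : nat -> K) : Prop :=
  (forall m, 0 <= a m) /\
  (forall m, (0 < m)%N -> a m.-1 * a m.+1 <= a m ^+ 2).

Definition log_concave_poly (K : numDomainType) (p : {poly K}) : Prop :=
  log_concave (fun m => p`_m).

(* The power series \sum_(n >= 1) g n * T ^+ n has positive radius of
   convergence; over R[i], 0 < r forces r to be real. *)
Definition analytic_at0 (K : numFieldType) (g : nat -> K) : Prop :=
  exists2 r : K, 0 < r &
    forall z : K, `|z| < r -> cvgn [series g n.+1 * z ^+ n.+1]_n.

(* Main.v *)
Require Import Defs.
From mathcomp Require Import all_boot all_order all_algebra.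
From mathcomp Require Import all_classical all_reals topology normedtype.
From mathcomp Require Import sequences.
From mathcomp Require Import complex.

Import Order.TTheory GRing.Theory Num.Theory.
Import numFieldNormedType.Exports.

Local Open Scope ring_scope.

(** Put G(T) = \sum_(k >= 1) (g k / k) T^k.  The two recursions say that the
    families have the generating series

      \sum_n P_n(x) T^n = 1 / (1 - x G(T))   for weights g k / k and h = 1,
      \sum_n Q_n(x) T^n = exp (x G(T))       for weights g k and h n = n,

    so the coefficient of x^m is [T^n] G^m for P_n and [T^n] G^m / m! for Q_n.
    Dividing a log-concave sequence a_m by m! keeps it log-concave, because
    (m!)^2 <= (m-1)! (m+1)!, that is m <= m+1.

    The comparison of coefficients is formal.  Only the coefficients of T^j
    with j <= n matter, so G is replaced by its truncation, a
    polynomial.  For P_n the recursion is then the product G^(m+1) = G * G^m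
    ([coef_recpoly_geom]); for Q_n it is the chain rule
    (G^(m+1))' = (m+1) G' G^m, as T G' has the coefficients g k
    ([coef_recpoly_exp]). *)

Section Coefficients.
Variable K : fieldType.
Implicit Types (g h : nat -> K).

Lemma coef0_recpoly g h n : (recpoly g h n)`_0 = (n == 0%N)%:R.
Proof.
case: n => [|n]; first by rewrite recpoly0 coef1.
by rewrite recpolyE // -scalerAl coefZ coefXM mulr0.
Qed.

Lemma coefS_recpoly g h n m :
  (recpoly g h n.+1)`_m.+1 =
    (h n.+1)^-1 * \sum_(k < n.+1) g k.+1 * (recpoly g h (n - k))`_m.
Proof.
rewrite recpolyE // -scalerAl coefZ coefXM /= coef_sum big_add1 /= big_mkord.
by congr (_ * _); apply: eq_bigr => k _; rewrite coefZ subSS.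
Qed.

(** The junk value c 0 is replaced by 0, so that the powers of this polynomial
    have no term of degree below the exponent. *)
Definition trunc_gen (c : nat -> K) (N : nat) : {poly K} :=
  \poly_(k < N.+1) (c k *+ (0 < k)).

Lemma coefS_trunc_gen c N k : (k < N)%N -> (trunc_gen c N)`_k.+1 = c k.+1.
Proof. by move=> ltkN; rewrite coef_poly ltnS ltkN. Qed.

Lemma coef0_trunc_gen_exp c N m : (trunc_gen c N ^+ m.+1)`_0 = 0.
Proof. by rewrite exprS coef0M coef_poly /= mul0r. Qed.

(** The recursion with h = 1 is multiplication by G: the coefficients of x^m
    are those of the expansion of 1 / (1 - x G) as a geometric series. *)
Lemma coef_recpoly_geom c N n m : (n <= N)%N ->
  (recpoly c (fun=> 1) n)`_m = (trunc_gen c N ^+ m)`_n.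
Proof.
elim: m n => [|m IHm] [|n] leN.
- by rewrite recpoly0 expr0.
- by rewrite coef0_recpoly expr0 coef1.
- by rewrite recpoly0 coef1 coef0_trunc_gen_exp.
rewrite coefS_recpoly invr1 mul1r exprS coefM [RHS]big_ord_recl /=.
rewrite coef_poly /= mul0r add0r; apply: eq_bigr => k _.
rewrite IHm ?(leq_trans (leq_subr _ _)) ?(ltnW leN) //.
by rewrite /bump add1n subSS coefS_trunc_gen // (leq_trans (ltn_ord k)).
Qed.

End Coefficients.

Arguments trunc_gen {K}.

(** The recursion is the differential equation T dQ/dT = x (T G') Q, whose
    solution with value 1 at T = 0 is Q = exp (x G). *)
Lemma coef_recpoly_exp (K : numFieldType) (g : nat -> K) N n m : (n <= N)%N ->
  (recpoly g (fun k => k%:R) n)`_m =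
    (trunc_gen (fun k => g k / k%:R) N ^+ m)`_n / m`!%:R.
Proof.
elim: m n => [|m IHm] [|n] leN.
- by rewrite recpoly0 expr0 divr1.
- by rewrite coef0_recpoly expr0 coef1 divr1.
- by rewrite recpoly0 coef1 coef0_trunc_gen_exp mul0r.
rewrite coefS_recpoly; set G := trunc_gen _ _.
have nzN k : k.+1%:R != 0 :> K by rewrite pnatr_eq0.
have -> : (G ^+ m.+1)`_n.+1 =
    n.+1%:R^-1 * (m.+1%:R * \sum_(k < n.+1) g k.+1 * (G ^+ m)`_(n - k)).
  (* After multiplication by n+1 this is the coefficient of T^n in
     (G^(m+1))' = (m+1) G' G^m. *)
  apply: (mulfI (nzN n)); rewrite mulVKf // !mulr_natl -coef_deriv deriv_exp /=.
  rewrite coefMn coefM; congr (_ *+ _); apply: eq_bigr => k _.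
  rewrite coef_deriv coefS_trunc_gen ?(leq_trans (ltn_ord k)) //.
  by rewrite -[_ *+ _]mulr_natr divfK.
rewrite -mulrA; congr (_ * _).
rewrite [_%:R * _]mulrC -mulrA factS natrM invfM mulVKf // mulr_suml.
apply: eq_bigr => k _; rewrite IHm ?mulrA //.
by rewrite (leq_trans (leq_subr _ _)) // ltnW.
Qed.

(** The sequence 1 / m! is log-concave, and log-concavity of non-negative
    sequences is stable under termwise products. *)
Lemma log_concave_div_fact (K : numFieldType) (a : nat -> K) :
  log_concave a -> log_concave (fun m => a m / m`!%:R).
Proof.
move=> [a_ge0 a_lc]; split=> [m|[|m] // _] /=; first exact: divr_ge0.
have fact_gt0R k : 0 < k`!%:R :> K by rewrite ltr0n fact_gt0.
rewrite expr_div_n mulf_div; apply: ler_pM.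
- exact: mulr_ge0.
- by rewrite invr_ge0 mulr_ge0 // ltW.
- exact: (a_lc m.+1).
rewrite lef_pV2 ?posrE ?exprn_gt0 ?mulr_gt0 // -natrX -natrM ler_nat.
by rewrite -mulnn {1}(factS m) (factS m.+1) mulnA leq_mul // mulnC leq_mul.
Qed.

Theorem corollary1 (R : realType) (g : nat -> R[i]) (n : nat)
    (g1 : g 1%N = 1) (g_analytic : analytic_at0 g) (n_ge1 : (1 <= n)%N) :
  log_concave_poly (recpoly (fun m => g m / m%:R) (fun _ => 1) n) ->
  log_concave_poly (recpoly g (fun m => m%:R) n).
Proof.
move=> /log_concave_div_fact lcP; rewrite /log_concave_poly.
have -> // : (fun m => (recpoly g (fun k => k%:R) n)`_m) =
    (fun m => (recpoly (fun k => g k / k%:R) (fun=> 1) n)`_m / m`!%:R).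
by apply: funext => m;
  rewrite (coef_recpoly_exp _ _ n) // (coef_recpoly_geom _ _ n).
Qed.
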